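(* For every integer $\ell\ge 5$, \[ \pi(C_\ell^-)=\begin{cases}0,&\text{if } 3\mid \ell,\\ \tfrac14,&\text{if } 3\nmid \ell.\end{cases} \]
   Context: A $3$-graph is a $3$-uniform hypergraph. For $\ell\ge 4$, $C_\ell^-$ is the $3$-graph on vertex set $[\ell]$ whose edges are $\{i,i+1,i+2\}$ for $1\le i\le \ell-2$ together with $\{\ell-1,\ell,1\}$ (the consecutive triples of the string $1\,2\cdots\ell\,1$). For a $3$-graph $H$, $\mathrm{ex}(H,n)$ is the maximum number of edges in a $3$-graph on $n$ vertices with no subgraph isomorphic to $H$, and $\pi(H)=\lim_{n\to\infty}\mathrm{ex}(H,n)/\binom n3$. *)

(* Defs.v *)
From HB Require Import structures.
From mathcomp Require Import all_boot all_order all_algebra.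
From mathcomp Require Import all_classical all_reals all_analysis.
Set Implicit Arguments.
Unset Strict Implicit.
Unset Printing Implicit Defensive.
Import Order.TTheory GRing.Theory Num.Theory.
Import numFieldNormedType.Exports.
Local Open Scope ring_scope.

(* A 3-graph on a finite vertex type T is given by its set of edges. *)
Definition three_graph (T : finType) (G : {set {set T}}) : bool :=
  [forall e in G, #|e| == 3%N].

(* G has a (not necessarily induced) subgraph isomorphic to H. *)
Definition contains_copy (V T : finType) (H : {set {set V}})
    (G : {set {set T}}) : bool :=
  [exists f : {ffun V -> T}, injectiveb f && [forall e in H, f @: e \in G]].

Definition turan_ex (V : finType) (H : {set {set V}}) (n : nat) : nat :=
  (\max_(G : {set {set 'I_n}} | three_graph G && ~~ contains_copy H G) #|G|)%N.

Definition turan_ratio (R : realType) (V : finType) (H : {set {set V}})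
    (n : nat) : R :=
  (turan_ex H n)%:R / 'C(n, 3)%:R.

(* [lim] is total, with a junk value when the sequence diverges; a claim about
   the value is meaningful only together with [cvgn (turan_ratio R H)]. *)
Definition turan_density (R : realType) (V : finType) (H : {set {set V}}) : R :=
  limn (turan_ratio R H).

(* With vertices numbered from 0 and [ordS] the cyclic successor, the edges
   are the triples {i, i+1, i+2} taken mod l for 0 <= i <= l - 2: those with
   i <= l - 3 do not wrap around, and i = l - 2 gives {l-2, l-1, 0}. *)
Definition tight_cycle_minus (l : nat) : {set {set 'I_l}} :=
  [set [set i; ordS i; ordS (ordS i)] | i : 'I_l & (i.+1 < l)%N].

(* Main.v *)
Require Import Defs.
From mathcomp Require Import all_boot all_order all_algebra.
From mathcomp Require Import all_classical all_reals all_analysis.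
From mathcomp Require Import ring lra zify.
Set Implicit Arguments.
Unset Strict Implicit.
Unset Printing Implicit Defensive.
Import Order.TTheory GRing.Theory Num.Theory.
Import numFieldNormedType.Exports.
Local Open Scope ring_scope.

(** Upper bound. Call z an apex of the triple {x, y, z} if x and y have a common
    neighbour in the link of z. A 3-graph without homomorphic image of C_5^- has
    at most one apex per triple, and none in an edge. A graph with e edges has at
    least 2e ordered pairs of (possibly equal) vertices with a common neighbour,
    because each x has at least max_(w ~ x) deg w partners; applied to all links
    of a 3-graph with E ordered edges on m vertices this gives 3E + E <= m^3.
    Every C_l^- with l >= 5 not divisible by 3 maps to C_5^-, and if 3 | l it maps
    to a single edge. Sampling m vertices at random turns a density excess into
    a positive density of homomorphic images of C_l^-, and a blow-up of one of
    them contains a genuine copy.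

    Lower bound. In the iterated balanced 3-partite construction a copy of C_l^-
    spreads over the parts at some level, where it must run through the three
    parts cyclically, so that 3 | l. *)

(** * Convexity and blow-ups of dense families of maps *)

(** Convexity, by induction: multiplying the bound by [x] overshoots the next one by
    [k.+1%:R * y ^+ k * (x - y) ^+ 2]. *)
Lemma expr_ge_tangent (R : realDomainType) (k : nat) (x y : R) :
  0 <= x -> 0 <= y -> y ^+ k.+1 + k.+1%:R * y ^+ k * (x - y) <= x ^+ k.+1.
Proof.
move=> x0 y0; elim: k => [|k IH]; first by rewrite !expr1 expr0; lra.
have h := ler_wpM2l x0 IH.
rewrite [leRHS]exprS; apply: le_trans h.
have yk : 0 <= y ^+ k by apply: exprn_ge0.
have : 0 <= k.+1%:R * y ^+ k * (x - y) ^+ 2.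
  by apply: mulr_ge0; [apply: mulr_ge0|apply: sqr_ge0].
rewrite -subr_ge0 => h2; rewrite -subr_ge0; congr (0 <= _): h2.
by rewrite !exprS -[k.+2%:R]natr1; ring.
Qed.

(** Sum the tangent bounds at [y]; the linear terms add up to a nonnegative number. *)
Lemma power_mean (R : realDomainType) (I : finType) (f : I -> R) (k : nat) (y : R) :
  (forall i, 0 <= f i) -> 0 <= y -> #|I|%:R * y <= \sum_i f i ->
  #|I|%:R * y ^+ k <= \sum_i f i ^+ k.
Proof.
move=> f0 y0 h; case: k => [|k].
  by rewrite mulr1 (eq_bigr (fun=> 1)) ?sumr_const ?lexx.
apply: (@le_trans _ _ (\sum_i (y ^+ k.+1 + k.+1%:R * y ^+ k * (f i - y)))).
  rewrite big_split /= sumr_const -[y ^+ k.+1 *+ _]mulr_natl lerDl -mulr_sumr.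
  by rewrite !mulr_ge0 ?exprn_ge0 // sumrB sumr_const -[y *+ _]mulr_natl subr_ge0.
by apply: ler_sum => i _; apply: expr_ge_tangent.
Qed.

Lemma sum_tuple_cons (R : nmodType) (T : finType) (k : nat)
    (F : seq T -> R) :
  \sum_(t : k.+1.-tuple T) F t = \sum_(x : T) \sum_(t : k.-tuple T) F (x :: t).
Proof.
rewrite pair_big /=.
rewrite (reindex (fun p : T * k.-tuple T => [tuple of p.1 :: p.2])) //.
exists (fun t => (thead t, [tuple of behead t])) => [[x t] _|t _] /=.
  by rewrite theadE; congr (_, _); apply: val_inj.
by rewrite -tuple_eta.
Qed.

(** Each entry of [Y] lists the clones of one coordinate, and [P] is required of every transversal.
    The recursion lets coordinates be blown up one by one. *)
Fixpoint all_choices (V J : finType) (P : seq V -> bool)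
    (Y : seq {ffun J -> V}) : bool :=
  if Y is w :: Y' then [forall j, all_choices (fun t => P (w j :: t)) Y']
  else P [::].

Lemma all_choicesP (V J : finType) (P : seq V -> bool) (k : nat)
    (Y : k.-tuple {ffun J -> V}) (g : 'I_k -> J) :
  all_choices P Y -> P [seq tnth Y i (g i) | i <- enum 'I_k].
Proof.
elim: k P Y g => [|k IH] P Y g.
  by rewrite tuple0 /= enum_ord0.
rewrite (tuple_eta Y) /= => /forallP/(_ (g ord0)) h.
rewrite enum_ordSl /= -map_comp tnth0.
have := IH _ [tuple of behead Y] (fun i => g (lift ord0 i)) h.
congr (is_true (P (_ :: _))).
by apply: eq_map => i /=; rewrite tnthS.
Qed.

Lemma sum_all_choices_cons (R : comNzRingType) (V J W : finType) (Q : W -> V -> bool) :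
  \sum_(x : W) \sum_(w : {ffun J -> V}) [forall j, Q x (w j)]%:R =
  \sum_(x : W) (\sum_(v : V) (Q x v)%:R) ^+ #|J| :> R.
Proof.
apply: eq_bigr => x _.
rewrite -prodr_const bigA_distr_bigA; apply: eq_bigr => w _ /=.
have -> : [forall j, Q x (w j)] = \big[andb/true]_j Q x (w j).
  by rewrite big_andE; apply: eq_forallb.
rewrite (big_morph (fun b : bool => b%:R) (id1 := 1) (op1 := *%R)) //.
by move=> a b; rewrite -natrM mulnb.
Qed.

(* The coordinates are blown up one at a time; by the power-mean inequality
   each of them raises the density to the power #|J|. *)
Lemma density_all_choices (R : realDomainType) (V J : finType) (k : nat)
    (A : finType) (P : A -> seq V -> bool) (c : R) :
  0 <= c ->
  c * (#|A| * #|V| ^ k)%:R <= \sum_a \sum_(t : k.-tuple V) (P a t)%:R ->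
  c ^+ (#|J| ^ k) * (#|A| * (#|V| ^ #|J|) ^ k)%:R <=
    \sum_a \sum_(Y : k.-tuple {ffun J -> V}) (all_choices (P a) Y)%:R.
Proof.
elim: k A P c => [|k IH] A P c c0.
  rewrite !expn0 expr1 muln1 => /le_trans; apply.
  by apply: ler_sum => a _; rewrite !(bigD1 [tuple] (P := xpredT)) //= lerD2l !big1 // => t;
    rewrite (tuple0 t).
rewrite (eq_bigr _ (fun a _ => sum_tuple_cons _ (fun t => (P a t)%:R))) /=.
rewrite pair_big /= => h.
(* The first coordinate joins [A]: it stays fixed while the induction hypothesis blows up the
   others. *)
have := IH (A * V)%type (fun p t => P p.1 (p.2 :: t)) c c0.
rewrite card_prod -mulnA -expnS => /(_ h) {}h.
rewrite (eq_bigr _ (fun a _ => sum_tuple_cons _ (fun Y => (all_choices (P a) Y)%:R))) /=.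
under eq_bigr do rewrite exchange_big /=.
rewrite pair_big /=.
rewrite (sum_all_choices_cons R J
  (fun (x : (A * k.-tuple {ffun J -> V})%type) v => all_choices (fun t => P x.1 (v :: t)) x.2)).
set d := c ^+ (#|J| ^ k) in h.
have -> : c ^+ (#|J| ^ k.+1) * (#|A| * (#|V| ^ #|J|) ^ k.+1)%:R =
   #|{: A * k.-tuple {ffun J -> V}}|%:R * (d * #|V|%:R) ^+ #|J|.
  rewrite card_prod card_tuple card_ffun expnS [(_ * _ ^ k)%N]mulnC exprM exprMn.
  by rewrite expnS !natrM !natrX; ring.
(* On average over pairs [(a, Y)], at least [d * #|V|] first coordinates fit all choices from
   [Y]. *)
apply: power_mean => [i||]; first by apply: sumr_ge0.
  by rewrite mulr_ge0 ?exprn_ge0.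
rewrite -(pair_big xpredT xpredT (fun a (Y : k.-tuple {ffun J -> V}) => \sum_v (all_choices (fun t => P a (v :: t)) Y)%:R)) /=.
under eq_bigr do rewrite exchange_big /=.
rewrite pair_big /=.
apply: le_trans h.
rewrite card_prod card_tuple card_ffun !natrM le_eqVlt; apply/orP; left.
by apply/eqP; ring.
Qed.

(** A map from [d] points to [n] points is non-injective with probability at most [d * d / n];
    denominators are cleared. *)
Lemma ffact_ge (R : realDomainType) (n d : nat) :
  n%:R ^+ d.+1 - d%:R * d%:R * n%:R ^+ d <= n%:R * (n ^_ d)%:R :> R.
Proof.
elim: d => [|d IH]; first by rewrite ffactn0 expr1; lra.
have nd : 0 <= n%:R ^+ d :> R by apply: exprn_ge0.
have n0 : 0 <= n%:R :> R by [].
have [nlt|le] := ltnP n d.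
  rewrite ffact_small 1?ltnW // mulr0 -[n%:R ^+ d.+2]mulr1 exprS.
  rewrite [n%:R ^+ d.+1]exprS -natrM -subr_ge0.
  have -> : 0 - (n%:R * (n%:R * n%:R ^+ d) * 1 - (d.+1 * d.+1)%:R * (n%:R * n%:R ^+ d))
     = ((d.+1 * d.+1)%:R - n%:R) * n%:R * n%:R ^+ d :> R by ring.
  rewrite !mulr_ge0 // subr_ge0 ler_nat; nia.
rewrite ffactnSr natrM natrB // mulrA.
have nd0 : 0 <= n%:R - d%:R :> R by rewrite subr_ge0 ler_nat.
apply: le_trans (ler_wpM2r nd0 IH).
rewrite !exprS -[d.+1%:R]natr1.
move: nd n0 (ler0n R d); set a := n%:R; set b := d%:R; set x := _ ^+ d => x0 a0 b0.
have h1 : 0 <= b * b * b * x by rewrite !mulr_ge0.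
have h2 : 0 <= (b + 1) * (a * x) by rewrite !mulr_ge0 ?addr_ge0.
nra.
Qed.

(** If [P] avoided all injective maps, its density would be at most [d * d / n < c], where
    [d = #|D|] and [n = #|V|]. *)
Lemma dense_contains_injective (R : realFieldType) (D V : finType)
    (P : pred {ffun D -> V}) (c : R) :
  0 < c -> (#|D| * #|D|)%:R < c * #|V|%:R ->
  c * #|V|%:R ^+ #|D| <= #|[set f | P f]|%:R ->
  exists2 f : {ffun D -> V}, injectiveb f & P f.
Proof.
move=> c0 hV hP; apply/exists_inP; apply: contraT; rewrite negb_exists_in => /forall_inP h.
set n := #|V| in hV hP *; set d := #|D| in hV hP *.
have n0 : 0 < n%:R :> R.
  by rewrite -(pmulr_rgt0 _ c0); apply: le_lt_trans hV.
have : (#|[set f | P f]| + n ^_ d <= n ^ d)%N.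
  rewrite -card_inj_ffuns -card_ffun -cardsT -cardsUI.
  rewrite (_ : _ :&: _ = finset.set0) ?cards0 ?addn0 ?subset_leq_card ?finset.subsetT //.
  by apply/setP => f; rewrite !inE; case: (boolP (injectiveb f)) => [/h/negbTE ->|]; rewrite ?andbF.
rewrite -(ler_nat R) natrD natrX => le1.
have := ffact_ge R n d; rewrite exprS => h2.
have nd : 0 < n%:R ^+ d :> R by apply: exprn_gt0.
rewrite natrM in hV.
move: nd n0 le1 h2 hV hP; set x := _ ^+ d; set a := n%:R; set b := d%:R.
set u := _%:R; set v := _%:R => x0 a0 h1 h2 h3 h4.
have h5 : (c * a - b * b) * x > 0 by rewrite mulr_gt0 // subr_gt0.
have h6 : a * (c * x + v) <= a * x by rewrite ler_pM2l //; lra.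
nra.
Qed.

(** Families [Y] all of whose transversals satisfy [P] have density at least [c ^+ (S ^ k)]; for
    large [V] one of them has distinct entries. *)
Lemma blowup (R : realFieldType) (k S : nat) (c : R) :
  0 < c -> exists N : R, forall (V : finType) (P : pred {ffun 'I_k -> V}),
    N < #|V|%:R -> c * #|V|%:R ^+ k <= #|[set f | P f]|%:R ->
    exists2 Y : 'I_k -> 'I_S -> V, injective (uncurry Y) &
      forall g : 'I_k -> 'I_S, P [ffun i => Y i (g i)].
Proof.
move=> c0; set c' := c ^+ (S ^ k); have c'0 : 0 < c' by apply: exprn_gt0.
(* The threshold of [dense_contains_injective] for [k * S] points and density [c']. *)
exists ((k * S * (k * S))%:R / c') => V P hV hP.
pose Q (t : seq V) := [exists f : {ffun 'I_k -> V}, P f && (t == [seq f i | i <- enum 'I_k])].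
have QE (f : {ffun 'I_k -> V}) : Q [seq f i | i <- enum 'I_k] = P f.
  apply/existsP/idP => [[f' /andP[Pf' /eqP /eq_in_map e]]|Pf].
    suff -> : f = f' by []; apply/ffunP => i; apply: e; exact: mem_enum.
  by exists f; rewrite Pf /=.
have := @density_all_choices R V 'I_S k unit (fun=> Q) c (ltW c0).
rewrite !big_const card_unit /= !addr0 !mul1n card_ord -/c'.
have -> : \sum_(t : k.-tuple V) (Q t)%:R = #|[set f | P f]|%:R :> R.
  rewrite -sum1_card natr_sum.
  rewrite (reindex (fun f : {ffun 'I_k -> V} => mktuple f)) /=; last first.
    exists (fun t => [ffun i => tnth t i]) => [f _|t _] /=.
      by apply/ffunP => i; rewrite ffunE tnth_mktuple.
    by apply: eq_from_tnth => i; rewrite tnth_mktuple ffunE.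
  rewrite [RHS]big_mkcond /=; apply: eq_bigr => f _.
  by rewrite inE QE; case: (P f).
rewrite natrX => /(_ hP) h.
pose phi (Y : k.-tuple {ffun 'I_S -> V}) : {ffun 'I_k * 'I_S -> V} :=
  [ffun p : 'I_k * 'I_S => tnth Y p.1 p.2].
have phi_inj : injective phi.
  move=> Y Z /ffunP e; apply: eq_from_tnth => i; apply/ffunP => j.
  by have := e (i, j); rewrite !ffunE.
have [||f finj] := @dense_contains_injective R ('I_k * 'I_S)%type V
  (fun f => [exists Y : k.-tuple {ffun 'I_S -> V}, all_choices Q Y && (f == phi Y)]) c' c'0.
- rewrite card_prod !card_ord; move: hV; rewrite ltr_pdivrMr // mulrC; exact.
- move: h; rewrite card_prod !card_ord -expnM -natrX [(k * S)%N]mulnC => /le_trans; apply.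
  rewrite -(natr_sum _ _ xpredT) ler_nat.
  have -> : (\sum_(Y : k.-tuple {ffun 'I_S -> V}) all_choices Q Y =
             #|[set phi Y | Y in [pred Y : k.-tuple {ffun 'I_S -> V} | all_choices Q Y]]|)%N.
    by rewrite card_imset // -sum1_card [RHS]big_mkcond.
  apply/subset_leq_card/fintype.subsetP => f /imsetP[Y hY ->].
  by rewrite inE; apply/existsP; exists Y; rewrite eqxx andbT.
move=> /existsP[Y /andP[hY /eqP fE]].
exists (fun i j => tnth Y i j).
  apply: (eq_inj (injectiveP _ finj)) => -[i j]; by rewrite fE ffunE.
move=> g; rewrite -QE.
have := all_choicesP g hY.
by congr (is_true (Q _)); apply: eq_map => i; rewrite ffunE.
Qed.

(** * Closed walks in triple systems *)

(** Swap and rotation generate all permutations of the arguments, so the single disequality makes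
    all three vertices distinct. *)
Definition triple_system (T : eqType) (E : T -> T -> T -> bool) :=
  [/\ forall x y z, E x y z -> E y x z,
      forall x y z, E x y z -> E y z x
    & forall x y z, E x y z -> x != y].

Fixpoint tight_walk (T : Type) (E : T -> T -> T -> bool) (s : seq T) : bool :=
  if s is x :: (y :: z :: _) as s' then E x y z && tight_walk E s' else true.

(* Closed walks of length [size s] are the homomorphic images of
   [tight_cycle_minus (size s)]. *)
Definition minus_cycle_walk (T : Type) (E : T -> T -> T -> bool) (s : seq T) :=
  if s is x :: _ then tight_walk E (rcons s x) else false.

(** A closed walk may run round its first edge once more, [x y z x y z ...], which adds three to its
    length. *)
Lemma minus_cycle_walkD3 (T : eqType) (E : T -> T -> T -> bool) (s : seq T) (k : nat) :
  triple_system E -> (3 <= size s)%N -> minus_cycle_walk E s ->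
  exists2 s', size s' = (size s + 3 * k)%N & minus_cycle_walk E s'.
Proof.
move=> [_ rot _] s3 hs.
suff [s' sz /andP[_ hs']] : exists2 s' : seq T, size s' = (size s + 3 * k)%N &
    (3 <= size s')%N && minus_cycle_walk E s' by exists s'.
elim: k => [|k [s' sz /andP[s'3 hs']]]; first by exists s; rewrite ?muln0 ?addn0 ?s3.
case: s' => [//|x [//|y [//|z r]]] in sz s'3 hs'.
exists [:: x, y, z, x, y, z & r]; first by move: sz => /=; lia.
by move: hs' => /= /andP[h ->]; rewrite h (rot _ _ _ h) (rot _ _ _ (rot _ _ _ h)).
Qed.

Lemma minus_cycle_walk_dvd3 (T : eqType) (E : T -> T -> T -> bool) (l : nat) (x y z : T) :
  triple_system E -> (0 < l)%N -> (3 %| l)%N -> E x y z ->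
  exists2 s, size s = l & minus_cycle_walk E s.
Proof.
move=> HE l0 /dvdnP[q lE] h; have [_ rot _] := HE.
have [||s ss hs] := @minus_cycle_walkD3 T E [:: x; y; z] q.-1 HE.
- by [].
- by rewrite /= h (rot _ _ _ h).
by exists s => //; rewrite ss /=; lia.
Qed.

(** The four edges form an image of [C_5^-]. If [l] is 2 modulo 3, extend the walk [a b c d e] by
    multiples of three. *)
Lemma minus_cycle_walk_not_dvd3 (T : eqType) (E : T -> T -> T -> bool) (l : nat)
    (a b c d e : T) :
  triple_system E -> (5 <= l)%N -> ~~ (3 %| l)%N ->
  E a b c -> E b c d -> E c d e -> E d e a ->
  exists2 s, size s = l & minus_cycle_walk E s.
Proof.
move=> HE l5 l3 h1 h2 h3 h4; have [sw rot _] := HE.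
have [l1|l1] : (l = 5 + 3 * ((l - 5) %/ 3) \/ l = 7 + 3 * ((l - 7) %/ 3))%N by lia.
  have [||s ss hs] := @minus_cycle_walkD3 T E [:: a; b; c; d; e] ((l - 5) %/ 3) HE.
  - by [].
  - by rewrite /= h1 h2 h3 h4.
  by exists s => //; rewrite ss.
(* If [l] is 1 modulo 3, start from a closed walk of length 7 through the same four edges. *)
have [||s ss hs] := @minus_cycle_walkD3 T E [:: a; d; e; c; d; b; c] ((l - 7) %/ 3) HE.
- by [].
- rewrite /= (rot _ _ _ (rot _ _ _ h4)) (rot _ _ _ h3) (rot _ _ _ (rot _ _ _ h3)).
  by rewrite (rot _ _ _ h2) (rot _ _ _ (rot _ _ _ h2)) (rot _ _ _ h1).
by exists s => //; rewrite ss.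
Qed.

(** * Counting edges and apexes *)

(** Give each ordered pair [x y] of neighbours the weight [c x / d x]. The weights at [x] sum to at
    most [c x], while those of [x y] and [y x] together are at least
    [d y / d x + d x / d y >= 2]. *)
Lemma sum_degree_le (T : finType) (L : rel T) (c d : T -> nat) :
  symmetric L -> (forall x, d x = \sum_y L x y)%N ->
  (forall x y, L x y -> d y <= c x)%N ->
  (\sum_x d x <= \sum_x c x)%N.
Proof.
move=> Ls dE hc.
rewrite -(ler_nat rat) !natr_sum.
pose q (x y : T) : rat := (c x)%:R / (d x)%:R.
have dpos x y : L x y -> 0 < (d x)%:R :> rat.
  by move=> h; rewrite ltr0n dE (bigD1 y) //= h.
have sumE : \sum_x \sum_(y | L x y) q x y <= \sum_x (c x)%:R.
  apply: ler_sum => x _.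
  have -> : \sum_(y | L x y) q x y = (d x)%:R * q x x.
    by rewrite dE natr_sum mulr_suml big_mkcond; apply: eq_bigr => y _; case: (L x y);
       rewrite ?mul1r ?mul0r.
  rewrite /q; case: (eqVneq (d x) 0%N) => [->|d0]; first by rewrite mul0r.
  by rewrite mulrC divfK // pnatr_eq0.
have sumE' : \sum_x \sum_(y | L x y) q x y = \sum_x \sum_(y | L x y) q y x.
  rewrite (exchange_big_dep xpredT) //=; apply: eq_bigr => x _.
  by apply: eq_bigl => y; rewrite Ls.
have : \sum_x (d x)%:R *+ 2 <= \sum_x \sum_(y | L x y) (q x y + q y x).
  apply: ler_sum => x _.
  rewrite dE natr_sum -sumrMnl [leRHS]big_mkcond /=; apply: ler_sum => y _.
  case: ifP => // h.
  have dx := dpos _ _ h; have dy := dpos y x; rewrite Ls in dy; move/(_ h): dy => dy.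
  have cx : (d y)%:R <= (c x)%:R :> rat by rewrite ler_nat hc.
  have cy : (d x)%:R <= (c y)%:R :> rat by rewrite ler_nat hc // Ls.
  apply: (@le_trans _ _ ((d y)%:R / (d x)%:R + (d x)%:R / (d y)%:R)); last first.
    by apply: lerD; rewrite ler_pM2r ?invr_gt0.
  rewrite addf_div ?gt_eqF // ler_pdivlMr ?mulr_gt0 // -subr_ge0.
  set a := _%:R; set b := _%:R.
  rewrite /= (_ : _ - _ = (a - b) ^+ 2) ?sqr_ge0 //; ring.
under [leRHS]eq_bigr do rewrite big_split /=.
rewrite [leRHS]big_split /= -sumE' -mulr2n sumrMnl.
by rewrite lerMn2r /= => /le_trans; apply.
Qed.

Lemma sum_rot (T : finType) (F : T -> T -> T -> nat) :
  (\sum_x \sum_y \sum_z F y z x = \sum_x \sum_y \sum_z F x y z)%N.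
Proof. by rewrite exchange_big; apply: eq_bigr => x _; apply: exchange_big. Qed.

Lemma sum3D (T : finType) (F G : T -> T -> T -> nat) :
  (\sum_x \sum_y \sum_z (F x y z + G x y z) =
   \sum_x \sum_y \sum_z F x y z + \sum_x \sum_y \sum_z G x y z)%N.
Proof.
rewrite -big_split; apply: eq_bigr => x _; rewrite -big_split.
by apply: eq_bigr => y _; rewrite -big_split.
Qed.

Lemma triple_count_le (T : finType) (E : T -> T -> T -> bool) :
  triple_system E ->
  (forall a b c d e, E a b c -> E b c d -> E c d e -> E d e a -> False) ->
  (4 * \sum_x \sum_y \sum_z E x y z <= #|T| ^ 3)%N.
Proof.
move=> [sw rot irr] h5.
(* [A x y z]: z is an apex of {x, y, z}. *)
pose A x y z := [exists p, E x p z && E y p z].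
have rot2 x y z : E x y z -> E z x y by move=> /rot /rot.
have at_most_one x y z : (E x y z + (A x y z + (A y z x + A z x y)) <= 1)%N.
  (* Two apexes in a triple span C_5^-. *)
  have AA a b c : A a b c -> A b c a -> False.
    move=> /existsP[p /andP[p1 p2]] /existsP[q /andP[q1 q2]].
    exact: (h5 b q a c p q1 (rot _ _ _ q2) (sw _ _ _ (rot2 _ _ _ p1)) (sw _ _ _ (rot _ _ _ p2))).
  (* An apex of an edge gives K_4^-, on which C_5^- folds. *)
  have EA a b c : E a b c -> A a b c -> False.
    move=> h /existsP[p /andP[p1 p2]].
    exact: (h5 a c b p c (sw _ _ _ (rot2 _ _ _ h)) (rot2 _ _ _ p2) p2 (rot _ _ _ p1)).
  have h1 : ~~ (A x y z && A y z x) by apply/negP => /andP[]; apply: AA.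
  have h2 : ~~ (A y z x && A z x y) by apply/negP => /andP[]; apply: AA.
  have h3 : ~~ (A z x y && A x y z) by apply/negP => /andP[]; apply: AA.
  have h4 : ~~ (E x y z && A x y z) by apply/negP => /andP[]; apply: EA.
  have h5' : ~~ (E x y z && A y z x) by apply/negP => /andP[/rot]; apply: EA.
  have h6 : ~~ (E x y z && A z x y) by apply/negP => /andP[/rot2]; apply: EA.
  move: (E x y z) (A x y z) (A y z x) (A z x y) h1 h2 h3 h4 h5' h6.
  by do 4!case.

(* In the link of [z], if [x] and [y] are adjacent, every neighbour [p] of [y] shares the neighbour
   [y] with [x]; so [x] has at least [deg y] partners. *)
have sumA : (\sum_z \sum_x \sum_y E x y z <= \sum_z \sum_x \sum_y A x y z)%N.
  apply: leq_sum => z _.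
  apply: (@sum_degree_le T (fun x y => E x y z)) => [x y|//|x y h].
    by apply/idP/idP; apply: sw.
  apply: leq_sum => p _.
  case hp : (E y p z) => //=; rewrite lt0b; apply/existsP; exists y; rewrite h.
  exact: sw.
have : (\sum_x \sum_y \sum_z (E x y z + (A x y z + (A y z x + A z x y))) <= #|T| ^ 3)%N.
  apply: (@leq_trans (\sum_(x : T) \sum_(y : T) \sum_(z : T) 1)%N).
    by do 3!(apply: leq_sum => ? _).
  by rewrite !sum_nat_const !muln1 !expnS muln1.
rewrite (sum3D E) (sum3D A) (sum3D (fun x y z => A y z x)).
(* By rotation of the variables the three apex terms have equal sums, each at least the edge sum. *)
rewrite (sum_rot A) -(sum_rot (fun x y z => A z x y)).
move: sumA; rewrite (sum_rot E) (sum_rot A).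
lia.
Qed.

(** * Ordered edge counts and random sampling *)

Lemma cards3 (T : finType) (x y z : T) :
  (#|[set x; y; z]| == 3)%N = [&& x != y, x != z & y != z].
Proof.
by rewrite finset.setUC cardsU1 cards2 !inE negb_or -!(eq_sym z); case: (x != y); do 2!case: (z != _).
Qed.

Lemma set3_eq (T : finType) (e : {set T}) (x y z : T) : #|e| = 3%N ->
  ([set x; y; z] == e) = [&& x \in e, y \in e :\ x & z \in e :\ x :\ y].
Proof.
move=> e3; apply/eqP/and3P => [exyz|[xe]].
  have : (#|[set x; y; z]| == 3)%N by rewrite exyz e3.
  rewrite cards3 => /and3P[xy xz yz].
  by rewrite -exyz !inE !eqxx !orbT !andbT; split; rewrite // eq_sym ?xy // yz eq_sym xz.
rewrite !inE => /andP[yx ye] /and3P[zy zx ze]; apply/eqP; rewrite eqEcard e3.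
have /eqP -> : (#|[set x; y; z]| == 3)%N by rewrite cards3 -!(eq_sym z) eq_sym yx zx.
by rewrite leqnn andbT; apply/fintype.subsetP => t; rewrite !inE => /orP[/orP[]|] /eqP->.
Qed.

Lemma sum_distinct3 (T : finType) (A : {set T}) (c : nat) :
  (\sum_(x in A) \sum_(y in A :\ x) \sum_(z in A :\ x :\ y) c = #|A| ^_ 3 * c)%N.
Proof.
have -> : (#|A| ^_ 3 * c = \sum_(x in A) (#|A|.-1 * (#|A|.-2 * c)))%N.
  by rewrite sum_nat_const !ffactnS ffactn0; lia.
apply: eq_bigr => x xA; have := cardsD1 x A; rewrite xA add1n => ->.
rewrite -sum_nat_const; apply: eq_bigr => y yA; have := cardsD1 y (A :\ x).
by rewrite yA add1n => -> /=; rewrite sum_nat_const.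
Qed.

(** Each edge has 3! orderings, and a triple with a repetition spans a set too small to be an
    edge. *)
Lemma sum_three_graph (T : finType) (G : {set {set T}}) : three_graph G ->
  (\sum_x \sum_y \sum_z ([set x; y; z] \in G) = 6 * #|G|)%N.
Proof.
move=> /forall_inP G3.
have memE x y z : ([set x; y; z] \in G : nat) = (\sum_(e in G) ([set x; y; z] == e))%N.
  case: (boolP (_ \in G)) => sG; last first.
    by rewrite big1 // => e eG; case: eqP => // se; rewrite se eG in sG.
  by rewrite (bigD1 [set x; y; z]) //= eqxx big1 // => e /andP[_ /negbTE]; rewrite eq_sym => ->.
under eq_bigr do under eq_bigr do under eq_bigr do rewrite memE.
under eq_bigr do under eq_bigr do rewrite exchange_big /=.
under eq_bigr do rewrite exchange_big /=.
rewrite exchange_big /= mulnC -sum_nat_const; apply: eq_bigr => e eG.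
have e3 : #|e| = 3%N by apply/eqP/G3.
transitivity (\sum_(x in e) \sum_(y in e :\ x) \sum_(z in e :\ x :\ y) 1)%N; last first.
  by rewrite sum_distinct3 e3.
rewrite [RHS]big_mkcond; apply: eq_bigr => x _.
under eq_bigr do under eq_bigr do rewrite set3_eq //.
case: (x \in e) => /=; last by rewrite big1 // => y _; rewrite big1.
rewrite [RHS]big_mkcond; apply: eq_bigr => y _.
case: (y \in _) => /=; last by rewrite big1.
by rewrite [RHS]big_mkcond; apply: eq_bigr => z _; case: (z \in _).
Qed.

(** Redrawing coordinate [i] keeps the average: exchanging [v] with [f i] is an involution on the
    pairs [(f, v)]. *)
Lemma sum_resample (I V : finType) (i : I) (Phi : {ffun I -> V} -> nat) :
  (#|V| * \sum_f Phi f = \sum_(f : {ffun I -> V}) \sum_v Phi [ffun j => if j == i then v else f j])%N.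
Proof.
rewrite big_distrr /=.
under eq_bigr do rewrite -sum_nat_const.
rewrite !pair_big /=.
pose u (p : {ffun I -> V} * V) := ([ffun j => if j == i then p.2 else p.1 j], p.1 i).
have uK : involutive u.
  move=> [f v]; congr (_, _) => /=; last by rewrite ffunE eqxx.
  by apply/ffunP => j; rewrite !ffunE; case: (eqVneq j i) => [->|].
rewrite (reindex_inj (inv_inj uK)) /=.
by apply: eq_bigr.
Qed.

(** Resample [i], [j], [k] in turn; afterwards the summand no longer depends on [f]. *)
Lemma sum_ffun3 (I V : finType) (e : V -> V -> V -> nat) (i j k : I) :
  i != j -> i != k -> j != k ->
  (#|V| ^ 3 * \sum_(f : {ffun I -> V}) e (f i) (f j) (f k) =
   #|V| ^ #|I| * \sum_x \sum_y \sum_z e x y z)%N.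
Proof.
move=> ij ik jk.
have ji : (j == i) = false by rewrite eq_sym (negbTE ij).
have ki : (k == i) = false by rewrite eq_sym (negbTE ik).
have kj : (k == j) = false by rewrite eq_sym (negbTE jk).
rewrite !expnS expn0 muln1 -!mulnA (sum_resample i (fun f => e (f i) (f j) (f k))).
rewrite (eq_bigr (fun f : {ffun I -> V} => \sum_x e x (f j) (f k))%N) => [|f _]; last first.
  by apply: eq_bigr => x _; rewrite !ffunE eqxx ji ki.
rewrite (sum_resample j (fun f => \sum_x e x (f j) (f k))%N).
rewrite (eq_bigr (fun f : {ffun I -> V} => \sum_y \sum_x e x y (f k))%N) => [|f _]; last first.
  by apply: eq_bigr => y _; apply: eq_bigr => x _; rewrite !ffunE eqxx kj.
rewrite (sum_resample k (fun f => \sum_y \sum_x e x y (f k))%N).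
rewrite (eq_bigr (fun _ : {ffun I -> V} => \sum_z \sum_y \sum_x e x y z)%N) => [|f _]; last first.
  by do 3!(apply: eq_bigr => ? _); rewrite ffunE eqxx.
rewrite sum_nat_const card_ffun; congr (_ * _)%N.
rewrite exchange_big (eq_bigr _ (fun y _ => exchange_big _ _ _ _ _ _)) /=.
by rewrite exchange_big.
Qed.

(** Index triples with a repetition are dropped; each of the [m ^_ 3] others sees a uniformly random
    triple of [V]. *)
Lemma sampling (V : finType) (e : V -> V -> V -> nat) (m : nat) :
  (m ^_ 3 * (#|V| ^ m * \sum_x \sum_y \sum_z e x y z) <=
   #|V| ^ 3 * \sum_(f : {ffun 'I_m -> V}) \sum_i \sum_j \sum_k e (f i) (f j) (f k))%N.
Proof.
set c := (#|V| ^ m * _)%N.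
have := sum_distinct3 [set: 'I_m] c; rewrite cardsT card_ord => <-.
rewrite exchange_big big_distrr [leqLHS]big_mkcond /=; apply: leq_sum => i _; rewrite inE.
rewrite exchange_big big_distrr [leqLHS]big_mkcond /=; apply: leq_sum => j _.
rewrite !inE andbT; case: ifP => // ji.
rewrite exchange_big big_distrr [leqLHS]big_mkcond /=; apply: leq_sum => k _.
rewrite !inE andbT; case: ifP => // /andP[kj ki].
by rewrite sum_ffun3 ?card_ord // eq_sym.
Qed.

(** * From walks and blow-ups to copies of the cycle *)

Lemma tight_walkP (T : Type) (E : T -> T -> T -> bool) (x0 : T) (s : seq T) (i : nat) :
  tight_walk E s -> (i.+2 < size s)%N ->
  E (nth x0 s i) (nth x0 s i.+1) (nth x0 s i.+2).
Proof.
elim: s i => [//|x [|y [|z r]] IH] i //; case: i => [|i] /= /andP[h hs] // ilt.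
exact: IH.
Qed.

Lemma val_ordS (l : nat) (a : 'I_l) : (a.+1 < l)%N -> ordS a = a.+1 :> nat.
Proof. by move=> h; rewrite /= modn_small. Qed.

Lemma minus_cycle_walk_nth (T : Type) (E : T -> T -> T -> bool) (x0 : T) (s : seq T)
    (l : nat) (a : 'I_l) :
  size s = l -> minus_cycle_walk E s -> (a.+1 < l)%N ->
  E (nth x0 s a) (nth x0 s (ordS a)) (nth x0 s (ordS (ordS a))).
Proof.
case: s => [//|x s] sl hs al.
have := @tight_walkP T E x0 _ a hs; rewrite size_rcons sl ltnS => /(_ al).
have e1 := val_ordS al.
have -> : ordS (ordS a) = (a.+2 %% l)%N :> nat by rewrite -e1.
rewrite !nth_rcons e1 sl (ltnW al) al; case: ltnP => [a2|a2]; first by rewrite modn_small.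
(* Only the last triple of the walk remains, which ends at the repeated first vertex. *)
have la : a.+2 = l by apply/eqP; rewrite eqn_leq a2 al.
by rewrite la eqxx modnn.
Qed.

Lemma triple_system_pullback (S T : finType) (G : {set {set T}}) (f : S -> T) :
  three_graph G -> triple_system (fun i j k => [set f i; f j; f k] \in G).
Proof.
move=> /forall_inP G3; split=> [x y z|x y z|x y z h].
- by rewrite (finset.setUC [set f x]).
- by rewrite -finset.setUA finset.setUC.
apply: contraTneq h => ->; apply/negP => /G3.
by rewrite cards3 eqxx.
Qed.

(* One coordinate of the blow-up is chosen per edge: distinct vertices of an
   edge lie in distinct classes, so the choices do not conflict. *)
Lemma contains_copy_blowup (l m : nat) (T : finType) (G : {set {set T}})
    (w : 'I_l -> 'I_m) (Y : 'I_m -> 'I_l -> T) :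
  three_graph G -> injective (uncurry Y) ->
  (forall (g : 'I_m -> 'I_l) (a : 'I_l), (a.+1 < l)%N ->
    [set Y (w a) (g (w a)); Y (w (ordS a)) (g (w (ordS a)));
         Y (w (ordS (ordS a))) (g (w (ordS (ordS a))))] \in G) ->
  contains_copy (tight_cycle_minus l) G.
Proof.
move=> /forall_inP G3 Yinj hY; apply/existsP; exists [ffun a => Y (w a) a].
apply/andP; split.
  apply/injectiveP => a b; rewrite !ffunE => e.
  by have [] := Yinj (w a, a) (w b, b) e.
apply/forall_inP => e /imsetP[a]; rewrite inE => al ->.
rewrite !imsetU !imset_set1 !ffunE.
set b := ordS a; set c := ordS b.
(* Under a constant choice, equal classes would identify two vertices of an edge; so the three
   classes differ. *)
have := G3 _ (hY (fun=> a) a al); rewrite cards3 => /and3P[ab ac bc].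
have wab : w a != w b by apply: contraNneq ab => ->.
have wac : w a != w c by apply: contraNneq ac => ->.
have wbc : w b != w c by apply: contraNneq bc => ->.
have := hY (fun i => if i == w a then a else if i == w b then b else c) a al.
by rewrite -/b -/c eqxx !(eq_sym _ (w a)) (negbTE wab) (negbTE wac) eqxx eq_sym (negbTE wbc).
Qed.

(** * Upper bound: from homomorphic images to copies *)

Section UpperBound.
Variables (R : archiRealFieldType) (l : nat) (alpha : R).
Hypothesis alpha0 : 0 <= alpha.
Hypothesis alphaP : forall (m : nat) (E : 'I_m -> 'I_m -> 'I_m -> bool),
  triple_system E ->
  (forall s, size s = l -> ~~ minus_cycle_walk E s) ->
  (\sum_i \sum_j \sum_k E i j k)%:R <= alpha * m%:R ^+ 3.

(** Average over all maps [f] from ['I_m] to [T]. The pulled-back system has at most [alpha * m ^ 3]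
    ordered edges unless it contains a homomorphic image, and such [f] are rare, since otherwise a
    blow-up would give a copy. *)
Lemma copy_free_sampling (m : nat) (eps : R) : (0 < m)%N -> 0 < eps ->
  exists N : nat, forall (T : finType) (G : {set {set T}}), (N <= #|T|)%N ->
    three_graph G -> ~~ contains_copy (tight_cycle_minus l) G ->
    (m ^_ 3 * (6 * #|G|))%:R <= (alpha + eps) * m%:R ^+ 3 * #|T|%:R ^+ 3.
Proof.
move=> m0 eps0.
(* There are [m ^ l] maps [w]; with this share for each, the union bound totals [eps]. *)
have c0 : 0 < eps / m%:R ^+ l by rewrite divr_gt0 // exprn_gt0 // ltr0n.
have [N0 hN0] := blowup m l c0.
exists (Num.bound `|N0|).+1 => T G NT G3 Gfree.
have NT' : N0 < #|T|%:R.
  apply: le_lt_trans (ler_norm _) _; apply: lt_le_trans (archi_boundP (normr_ge0 _)) _.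
  by rewrite ler_nat; apply: ltnW.
pose E (f : {ffun 'I_m -> T}) i j k := [set f i; f j; f k] \in G.
pose hom (w : {ffun 'I_l -> 'I_m}) f := [forall a : 'I_l, (a.+1 < l)%N ==> E f (w a) (w (ordS a)) (w (ordS (ordS a)))].
have hom_few (w : {ffun 'I_l -> 'I_m}) : #|[set f | hom w f]|%:R <= eps / m%:R ^+ l * #|T|%:R ^+ m.
  rewrite leNgt; apply: contra Gfree => /ltW hw.
  have [Y Yinj hY] := hN0 T (hom w) NT' hw.
  apply: (contains_copy_blowup G3 Yinj (w := w)) => g a al.
  by have /forallP/(_ a)/implyP/(_ al) := hY g; rewrite /E !ffunE.
have homP f : (\sum_i \sum_j \sum_k E f i j k)%:R <=
    alpha * m%:R ^+ 3 + (\sum_w hom w f)%:R * m%:R ^+ 3.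
  have [[w hw]|nohom] := pselect (exists w, hom w f).
    rewrite -[leLHS]add0r lerD ?mulr_ge0 ?exprn_ge0 //.
    apply: (@le_trans _ _ (m%:R ^+ 3)); last first.
      by rewrite ler_peMl ?exprn_ge0 // (bigD1 w) //= hw natrD lerDl.
    rewrite -natrX ler_nat.
    apply: (@leq_trans (\sum_(i < m) \sum_(j < m) \sum_(k < m) 1)%N).
      by do 3!(apply: leq_sum => ? _); apply: leq_b1.
    by rewrite !sum_nat_const !card_ord !expnS muln1.
  rewrite [X in _ + X%:R * _]big1 => [|w _]; last first.
    by case hw : (hom w f) => //; case: nohom; exists w.
  rewrite mul0r addr0; apply: alphaP; first exact: triple_system_pullback.
  move=> s sl; apply/negP => hs; apply: nohom.
  exists [ffun a : 'I_l => nth (Ordinal m0) s a]; apply/forallP => a; apply/implyP => al.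
  by rewrite !ffunE; apply: minus_cycle_walk_nth hs al.
have T0 : 0 < #|T|%:R :> R by rewrite ltr0n (leq_trans _ NT).
have mR : 0 < m%:R :> R by rewrite ltr0n.
have := sampling (fun x y z => nat_of_bool ([set x; y; z] \in G)) m.
rewrite (sum_three_graph G3) -(ler_nat R) mulnCA natrM natrX [(#|T| ^ 3 * _)%:R]natrM natrX.
set S := (\sum_f _)%N => hS.
have {}hS : #|T|%:R ^+ m * (m ^_ 3 * (6 * #|G|))%:R <= #|T|%:R ^+ 3 * ((alpha + eps) * m%:R ^+ 3 * #|T|%:R ^+ m).
  apply: (le_trans hS); rewrite ler_pM2l ?exprn_gt0 //.
  rewrite natr_sum; apply: (le_trans (ler_sum _ (fun f _ => homP f))).
  rewrite big_split /= sumr_const card_ffun card_ord -[_ *+ (_ ^ _)]mulr_natl natrX -mulr_suml.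
  rewrite -natr_sum exchange_big natr_sum /=.
  have -> : (alpha + eps) * m%:R ^+ 3 * #|T|%:R ^+ m =
    #|T|%:R ^+ m * (alpha * m%:R ^+ 3) + (eps * #|T|%:R ^+ m) * m%:R ^+ 3 by ring.
  rewrite lerD2l ler_pM2r ?exprn_gt0 //.
  apply: (@le_trans _ _ (\sum_(w : {ffun 'I_l -> 'I_m}) eps / m%:R ^+ l * #|T|%:R ^+ m)).
    apply: ler_sum => w _; apply: le_trans (hom_few w).
    by rewrite ler_nat -sum1_card [leqRHS]big_mkcond; apply: leq_sum => f _; rewrite inE; case: (hom w f).
  rewrite sumr_const card_ffun !card_ord -[_ *+ (m ^ l)]mulr_natl natrX mulrA mulrCA divff ?mulr1 //.
  by rewrite expf_neq0 // gt_eqF.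
by rewrite -(ler_pM2l (exprn_gt0 m T0)) (le_trans hS) // le_eqVlt; apply/orP; left; apply/eqP; ring.
Qed.

Lemma ffact3_ge (n : nat) : n%:R ^+ 3 - 9%:R * n%:R ^+ 2 <= (n ^_ 3)%:R :> R.
Proof.
case: n => [|n]; first by rewrite !expr0n /= mulr0 subrr.
rewrite -(ler_pM2l (_ : 0 < n.+1%:R)) ?ltr0n //; apply: le_trans (ffact_ge R n.+1 3).
by rewrite le_eqVlt; apply/orP; left; apply/eqP; ring.
Qed.

Lemma copy_free_upper (eps : R) : 0 < eps ->
  exists N : nat, forall (T : finType) (G : {set {set T}}), (N <= #|T|)%N ->
    three_graph G -> ~~ contains_copy (tight_cycle_minus l) G ->
    #|G|%:R <= (alpha + eps) * 'C(#|T|, 3)%:R.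
Proof.
move=> eps0.
pose e := eps / 2; have e0 : 0 < e by rewrite divr_gt0.
pose b := alpha + e; have b0 : 0 < b by rewrite ltr_wpDl.
(* Chosen so that [b * (1 + d) + d = alpha + eps]. Large [m] and [#|T|] let falling factorials
   replace cubes up to the factors [1 - d] and [1 + d]. *)
pose d := e / (b + 1); have d0 : 0 < d by rewrite divr_gt0 // addr_gt0.
have dE : d * (b + 1) = e by rewrite /d divfK // gt_eqF // addr_gt0.
pose m := (Num.bound (9%:R / d)).+1.
have md : 9%:R <= d * m%:R.
  rewrite mulrC -ler_pdivrMr //; apply: ltW; apply: (lt_trans (archi_boundP _)).
    by rewrite divr_ge0 // ltW.
  by rewrite ltr_nat.
have m0 : 0 < m%:R :> R by rewrite ltr0n.
have [//|N1 hN] := @copy_free_sampling m e _ e0.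
exists (N1 + Num.bound (9%:R * (1 + d) / d)).+1 => T G NT G3 Gfree.
have {hN} := hN T G _ G3 Gfree => /(_ (leq_trans (leq_addr _ _) (ltnW NT))).
rewrite natrM -/b.
have Tn : 9%:R * (1 + d) <= d * #|T|%:R.
  rewrite [leRHS]mulrC -ler_pdivrMr //; apply: ltW; apply: (lt_trans (archi_boundP _)).
    apply: divr_ge0; last exact: ltW.
    by apply: mulr_ge0 => //; apply: addr_ge0 => //; apply: ltW.
  by rewrite ltr_nat (leq_trans _ NT) // ltnS leq_addl.
(* The trivial bound by all triples, used to absorb the loss [d * (6 * #|G|)]. *)
have Fle : (6 * #|G|)%:R <= (#|T| ^_ 3)%:R :> R.
  rewrite ler_nat -bin_ffact mulnC leq_mul2r -card_draws; apply/orP; right.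
  apply/subset_leq_card/fintype.subsetP => f fG; rewrite inE.
  by have /forall_inP/(_ f fG) := G3.
have := ffact3_ge m; have := ffact3_ge #|T|.
have -> : ('C(#|T|, 3))%:R = (#|T| ^_ 3)%:R / 6%:R :> R.
  by rewrite -bin_ffact natrM mulfK.
move: Fle; rewrite natrM => F1 F2 F3 F4.
have g0 : 0 <= #|G|%:R :> R by [].
move: (#|T| ^_ 3)%:R (m ^_ 3)%:R (#|G|%:R : R) g0 F1 F2 F3 F4 => t u g g0 F1 F2 F3 F4.
rewrite mulrA ler_pdivlMr // mulrC.
have {}g0 : 0 <= 6%:R * g by rewrite mulr_ge0.
have T0 : 0 <= #|T|%:R :> R by [].
move: m%:R #|T|%:R => p n in m0 md T0 Tn F1 F2 F3 F4 *.
have h1 : (1 - d) * p ^+ 3 <= u by nra.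
have h2 : n ^+ 3 <= (1 + d) * t by nra.
have h3 : (1 - d) * (6%:R * g) <= b * n ^+ 3.
  rewrite -(ler_pM2r (exprn_gt0 3 m0)).
  apply: (@le_trans _ _ (u * (6%:R * g))); last by apply: (le_trans F4); rewrite mulrAC.
  by rewrite mulrAC ler_wpM2r.
have h4 : b * n ^+ 3 <= b * ((1 + d) * t) by rewrite ler_pM2l.
have -> : alpha + eps = b + d * (b + 1) by rewrite dE /b /e; lra.
have h5 : d * (6%:R * g) <= d * t by rewrite ler_pM2l.
nra.
Qed.
End UpperBound.

(** * Lower bound: the iterated 3-partite construction *)

(* Three labels form an edge when their ternary expansions, at the lowest
   digit where they do not all agree, carry three distinct digits; this is the
   iterated balanced complete 3-partite construction. *)
Local Open Scope nat_scope.

Fixpoint ternary_edge (fuel x y z : nat) : bool :=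
  if fuel is f.+1 then
    if (x %% 3 == y %% 3) && (y %% 3 == z %% 3)
    then ternary_edge f (x %/ 3) (y %/ 3) (z %/ 3)
    else [&& x %% 3 != y %% 3, x %% 3 != z %% 3 & y %% 3 != z %% 3]
  else false.

Lemma triple_system_ternary (f : nat) : triple_system (ternary_edge f).
Proof.
elim: f => [//|f [sw rot irr]]; split=> x y z /=.
- by case: ifP => h hs; [rewrite ifT; [apply: sw|lia]|rewrite ifF; lia].
- by case: ifP => h hs; [rewrite ifT; [apply: rot|lia]|rewrite ifF; lia].
case: ifP => [_ /irr|_ /andP[+ _]]; first by apply: contraNneq => ->.
by apply: contraNneq => ->.
Qed.

(** Consider the lowest digits [d i]. Either all agree, and dividing by 3 gives a walk with less
    fuel; or every triple carries three distinct digits, so [d] has period 3 and [d l] differs from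
    [d 0]. *)
Lemma ternary_walk_free (l f : nat) (w : nat -> nat) : ~~ (3 %| l)%N -> (2 < l)%N ->
  (forall i, (i.+2 <= l)%N -> ternary_edge f (w i) (w i.+1) (w i.+2)) -> w l != w 0%N.
Proof.
move=> l3 l2; elim: f w => [|f IH] w hw; first by have := hw 0%N (ltnW l2).
pose d i := (w i %% 3)%N.
have dstep i : (i.+2 <= l)%N -> [/\ d i = d i.+1, d i.+1 = d i.+2 &
     ternary_edge f (w i %/ 3) (w i.+1 %/ 3) (w i.+2 %/ 3)] \/
     [/\ d i <> d i.+1, d i.+1 <> d i.+2 & d i <> d i.+2].
  move=> /hw /=; case: ifP => [/andP[/eqP ? /eqP ?] ?|_]; first by left.
  by move=> /and3P[/eqP ? /eqP ? /eqP ?]; right.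
have dlt i : (d i < 3)%N by rewrite ltn_mod.
case: (eqVneq (d 0%N) (d 1%N)) => d01.
  have dall i : (i < l)%N -> d i = d i.+1.
    elim: i => [//|i IHi] il; have := IHi (ltnW il); have := dstep i il.
    by move=> [[_ ->]//|[]].
  have /IH : forall i, (i.+2 <= l)%N -> ternary_edge f (w i %/ 3) (w i.+1 %/ 3) (w i.+2 %/ 3).
    by move=> i il; case: (dstep i il) => [[]//|[]]; rewrite dall // ltnW.
  by apply: contraNneq => ->.
have dne i : (i < l)%N -> d i <> d i.+1.
  elim: i => [_|i IHi il]; first exact/eqP.
  by have := IHi (ltnW il); case: (dstep i il) => [[->]|[]].
have ddist i : i.+2 <= l -> [/\ d i <> d i.+1, d i.+1 <> d i.+2 & d i <> d i.+2].
  by move=> il; case: (dstep i il) => // -[+ _ _]; have := dne i (ltnW il).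
have third a1 a2 a3 a4 : a1 < 3 -> a2 < 3 -> a3 < 3 -> a4 < 3 ->
    [/\ a1 <> a2, a2 <> a3 & a1 <> a3] -> [/\ a2 <> a3, a3 <> a4 & a2 <> a4] -> a4 = a1.
  by clear; move=> ? ? ? ? [? ? ?] [? ? ?]; lia.
have dper i : i <= l -> d i = d (i %% 3).
  elim/ltn_ind: i => -[|[|[|i]]] // IHi il.
  rewrite (_ : i.+3 %% 3 = i %% 3) -?IHi; [|lia|lia|lia].
  by apply: (@third _ (d i.+1) (d i.+2)) => //; apply: ddist; lia.
have : d l <> d 0.
  have [d0 d1 d2] := ddist 0 (ltnW l2).
  rewrite dper //; have [->|->] : l %% 3 = 1 \/ l %% 3 = 2 by lia.
    exact: nesym.
  exact: nesym.
by move=> h; apply: contra_notN h => /eqP; rewrite /d => ->.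
Qed.

Local Close Scope nat_scope.

Local Open Scope nat_scope.

(** Exactly [(n + 2 - i) %/ 3] numbers below [n] are congruent to [i] modulo 3. *)
Lemma sum_residues (n : nat) (g : nat -> nat) :
  \sum_(x < n) g x = \sum_(i < 3) \sum_(x < (n + 2 - i) %/ 3) g (3 * x + i).
Proof.
have sum3 q : \sum_(x < 3 * q) g x =
    \sum_(x < q) g (3 * x + 0) + \sum_(x < q) g (3 * x + 1) + \sum_(x < q) g (3 * x + 2).
  elim: q => [|q IH]; first by rewrite !big_ord0.
  rewrite (_ : 3 * q.+1 = (3 * q + 2).+1); last by lia.
  rewrite 4!big_ord_recr /= (_ : 3 * q + 2 = (3 * q + 1).+1); last by lia.
  rewrite big_ord_recr /= (_ : 3 * q + 1 = (3 * q).+1); last by lia.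
  rewrite big_ord_recr /= IH addn0; ring.
have bump0 k : bump 0 k = k.+1 by [].
rewrite !big_ord_recl big_ord0 /= !bump0 addn0.
rewrite (_ : n + 2 - 2 = n); last by lia.
set q := n %/ 3.
have [e|[e|e]] : n = 3 * q \/ n = (3 * q).+1 \/ n = (3 * q).+2 by rewrite /q; lia.
- rewrite (_ : (n + 2 - 0) %/ 3 = q) 1?(_ : (n + 2 - 1) %/ 3 = q); [|lia|lia].
  by rewrite e sum3; ring.
- rewrite (_ : (n + 2 - 0) %/ 3 = q.+1) 1?(_ : (n + 2 - 1) %/ 3 = q); [|lia|lia].
  by rewrite e !big_ord_recr /= sum3 addn0; ring.
rewrite (_ : (n + 2 - 0) %/ 3 = q.+1) 1?(_ : (n + 2 - 1) %/ 3 = q.+1); [|lia|lia].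
by rewrite e !big_ord_recr /= sum3 addn0 addn1; ring.
Qed.

Lemma sum3_residues (n : nat) (h : nat -> nat -> nat -> nat) :
  \sum_(x < n) \sum_(y < n) \sum_(z < n) h x y z =
  \sum_(i < 3) \sum_(j < 3) \sum_(k < 3)
    \sum_(x < (n + 2 - i) %/ 3) \sum_(y < (n + 2 - j) %/ 3) \sum_(z < (n + 2 - k) %/ 3)
      h (3 * x + i) (3 * y + j) (3 * z + k).
Proof.
rewrite (sum_residues _ (fun x => \sum_(y < n) \sum_(z < n) h x y z)).
apply: eq_bigr => i _.
under eq_bigr => x _ do rewrite (sum_residues _ (fun y => \sum_(z < n) h _ y z)).
rewrite exchange_big; apply: eq_bigr => j _ /=.
rewrite [RHS]exchange_big; apply: eq_bigr => x _ /=.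
rewrite [RHS]exchange_big; apply: eq_bigr => y _ /=.
exact: sum_residues.
Qed.

Definition ternary_count (f n : nat) : nat :=
  \sum_(x < n) \sum_(y < n) \sum_(z < n) ternary_edge f x y z.

(** [a], [b], [c] are the sizes of the residue classes. Three distinct lowest digits give
    [6 * (a * b * c)] triples, a common digit recurses into its class, and mixed triples are no
    edges. *)
Lemma ternary_countS (f n : nat) (a := (n + 2) %/ 3) (b := (n + 1) %/ 3) (c := n %/ 3) :
  ternary_count f.+1 n =
    6 * (a * b * c) + ternary_count f a + ternary_count f b + ternary_count f c.
Proof.
rewrite [LHS]/ternary_count (sum3_residues _ (fun x y z => nat_of_bool (ternary_edge f.+1 x y z))).
pose t i := (n + 2 - i) %/ 3.
transitivity (\sum_(i < 3) \sum_(j < 3) \sum_(k < 3)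
    if (i == j :> nat) && (j == k :> nat) then ternary_count f (t i)
    else if [&& i != j :> nat, i != k :> nat & j != k :> nat] then t i * t j * t k else 0).
  apply: eq_bigr => i _; apply: eq_bigr => j _; apply: eq_bigr => k _.
  have digit (x : nat) (r : 'I_3) : (3 * x + r) %% 3 = r by have := ltn_ord r; lia.
  have quo (x : nat) (r : 'I_3) : (3 * x + r) %/ 3 = x by have := ltn_ord r; lia.
  rewrite -!/(t _) /=.
  under eq_bigr do under eq_bigr do under eq_bigr do rewrite !digit !quo.
  case: ifP => [/andP[/eqP -> /eqP ->]//|_]; case: ifP => _.
    by rewrite !sum_nat_const !card_ord; lia.
  by rewrite big1 // => x _; rewrite big1 // => y _; rewrite big1.
have bump0 k : bump 0 k = k.+1 by [].
rewrite !big_ord_recl !big_ord0 /= !bump0 /=.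
have -> : t 0 = a by rewrite /t subn0.
have -> : t 1 = b by rewrite /t; congr (_ %/ _); lia.
have -> : t 2 = c by rewrite /t; congr (_ %/ _); lia.
ring.
Qed.

(** The cubic terms balance, as [24 / 27 + 3 / 27 = 1]; the slack [2 * n ^ 2] absorbs unequal class
    sizes and the cases [n < 3]. *)
Lemma ternary_count_ge (f n : nat) : n <= f -> n ^ 3 <= 4 * ternary_count f n + 2 * n ^ 2.
Proof.
elim: f n => [|f IH] n nf; first by have -> : n = 0 by lia.
rewrite ternary_countS.
case: (ltnP n 3) => n3; first by rewrite [n ^ 3]expnS (leq_trans _ (leq_addl _ _)) // leq_mul.
have h1 : n %/ 3 <= f by lia.
have h2 : (n + 1) %/ 3 <= f by lia.
have h3 : (n + 2) %/ 3 <= f by lia.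
move: (IH _ h1) (IH _ h2) (IH _ h3); clear IH.
have [[e1 [e2 e3]]|[[e1 [e2 e3]]|[e1 [e2 e3]]]] :
  n = 3 * (n %/ 3) /\ (n + 1) %/ 3 = n %/ 3 /\ (n + 2) %/ 3 = n %/ 3 \/
  n = 3 * (n %/ 3) + 1 /\ (n + 1) %/ 3 = n %/ 3 /\ (n + 2) %/ 3 = (n %/ 3).+1 \/
  n = 3 * (n %/ 3) + 2 /\ (n + 1) %/ 3 = (n %/ 3).+1 /\ (n + 2) %/ 3 = (n %/ 3).+1 by lia.
all: rewrite e2 e3; move: (n %/ 3) e1 => q -> {n n3 nf h1 h2 h3 e2 e3}; rewrite !expnS !expn0 !muln1.
all: nia.
Qed.

Local Close Scope nat_scope.

Lemma triple_system_set3 (T : finType) (E : T -> T -> T -> bool) (x y z x' y' z' : T) :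
  triple_system E -> [set x; y; z] = [set x'; y'; z'] -> E x' y' z' -> E x y z.
Proof.
move=> [sw rot irr] e h.
have d1 := irr _ _ _ h; have d2 := irr _ _ _ (rot _ _ _ h).
have d3 := irr _ _ _ (rot _ _ _ (rot _ _ _ h)); rewrite eq_sym in d3.
have : (#|[set x; y; z]| == 3)%N by rewrite e cards3 d1 d2 d3.
rewrite cards3 => /and3P[xy xz yz].
have : z \in [set x'; y'; z'] by rewrite -e !inE eqxx orbT.
have : y \in [set x'; y'; z'] by rewrite -e !inE eqxx orbT.
have : x \in [set x'; y'; z'] by rewrite -e !inE eqxx.
rewrite !inE => /orP[/orP[]|] /eqP ex /orP[/orP[]|] /eqP ey /orP[/orP[]|] /eqP ez.
all: try by move: xy xz yz; rewrite ex ey ez ?eqxx.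
all: rewrite ex ey ez; have h1 := rot _ _ _ h; have h2 := rot _ _ _ h1.
all: by [|apply: sw].
Qed.

Definition ternary_graph (n : nat) : {set {set 'I_n}} :=
  [set e | [exists x : 'I_n, exists y : 'I_n, exists z : 'I_n,
     (e == [set x; y; z]) && ternary_edge n x y z]].

Lemma ternary_graphE (n : nat) (x y z : 'I_n) :
  ([set x; y; z] \in ternary_graph n) = ternary_edge n x y z.
Proof.
have tE : triple_system (fun x y z : 'I_n => ternary_edge n x y z).
  have [sw rot irr] := triple_system_ternary n.
  by split=> *; [apply: sw|apply: rot|apply: irr; eassumption].
rewrite inE; apply/existsP/idP => [[x' /existsP[y' /existsP[z' /andP[/eqP e h]]]]|h].
  exact: (triple_system_set3 tE e h).
by exists x; apply/existsP; exists y; apply/existsP; exists z; rewrite eqxx.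
Qed.

Lemma ternary_three_graph (n : nat) : three_graph (ternary_graph n).
Proof.
apply/forall_inP => e; rewrite inE => /existsP[x /existsP[y /existsP[z /andP[/eqP -> h]]]].
have [sw rot irr] := triple_system_ternary n.
have d1 := irr _ _ _ h; have d2 := irr _ _ _ (rot _ _ _ h).
have d3 := irr _ _ _ (rot _ _ _ (rot _ _ _ h)); rewrite eq_sym in d3.
by rewrite cards3; apply/and3P.
Qed.

Lemma ternary_graph_free (n l : nat) : (2 < l)%N -> ~~ (3 %| l)%N ->
  ~~ contains_copy (tight_cycle_minus l) (ternary_graph n).
Proof.
move=> l2 l3; apply/existsP => -[f /andP[_ /forall_inP hf]].
have l0 : (0 < l)%N by lia.
(* Indices are read modulo [l], so [w l = w 0], contrary to [ternary_walk_free]. *)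
pose w i : nat := f (Ordinal (ltn_pmod i l0)).
have : w l != w 0%N.
  apply: (@ternary_walk_free l n w l3 l2) => i il; rewrite -ternary_graphE.
  have il' : (i < l)%N by lia.
  have -> : Ordinal (ltn_pmod i l0) = Ordinal il' by apply: val_inj; rewrite /= modn_small.
  have -> : Ordinal (ltn_pmod i.+1 l0) = ordS (Ordinal il') by apply: val_inj.
  have -> : Ordinal (ltn_pmod i.+2 l0) = ordS (ordS (Ordinal il')).
    by apply: val_inj; rewrite /= -[in RHS]addn1 modnDml addn1.
  rewrite -!(imset_set1 f) -!imsetU; apply: hf; apply/imsetP; exists (Ordinal il') => //.
  by rewrite inE.
by rewrite /w; case/eqP; congr (nat_of_ord (f _)); apply: val_inj; rewrite /= modnn mod0n.
Qed.

Lemma card_ternary_graph (n : nat) : (n ^ 3 <= 24 * #|ternary_graph n| + 2 * n ^ 2)%N.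
Proof.
have := @ternary_count_ge n n (leqnn n).
have <- : (6 * #|ternary_graph n| = ternary_count n n)%N.
  rewrite -(sum_three_graph (ternary_three_graph n)).
  by do 3!(apply: eq_bigr => ? _); rewrite ternary_graphE.
by rewrite mulnA.
Qed.

Lemma ternary_graph_dense (R : archiRealFieldType) (eps : R) : 0 < eps ->
  exists N : nat, forall n, (N <= n)%N ->
    (4^-1 - eps) * 'C(n, 3)%:R <= #|ternary_graph n|%:R.
Proof.
(* From this [n] on, [eps * n ^_ 3] pays for the quadratic error in the edge count. *)
move=> eps0; exists (Num.bound ((2^-1 + 9%:R * eps) / eps)) => n nN.
have {nN} h1 : 2^-1 + 9%:R * eps <= eps * n%:R.
  rewrite [leRHS]mulrC -ler_pdivrMr //; apply: ltW; apply: (lt_le_trans (archi_boundP _)).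
    by rewrite divr_ge0 ?(ltW eps0) // addr_ge0 ?mulr_ge0 ?(ltW eps0).
  by rewrite ler_nat.
have h2 := ffact3_ge R n.
have h3 : (n ^_ 3)%:R <= n%:R ^+ 3 :> R by rewrite -natrX ler_nat !ffactnS ffactn0 !expnS expn0 !muln1 !leq_mul //; lia.
have := card_ternary_graph n; rewrite -(ler_nat R) natrX natrD [(24 * _)%:R]natrM [(2 * _)%:R]natrM natrX => h4.
have -> : ('C(n, 3))%:R = (n ^_ 3)%:R / 6%:R :> R by rewrite -bin_ffact natrM mulfK.
have h5 : (2^-1 + 9%:R * eps) * n%:R ^+ 2 <= eps * n%:R * n%:R ^+ 2 by rewrite ler_wpM2r ?exprn_ge0.
rewrite mulrA ler_pdivrMr //.
have h6 : eps * (n%:R ^+ 3 - 9%:R * n%:R ^+ 2) <= eps * (n ^_ 3)%:R by rewrite ler_pM2l.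
nra.
Qed.

(** * Convergence of the ratios *)

Lemma cvg_turan_ratio (R : realType) (V : finType) (H : {set {set V}}) (a : R) :
  0 <= a ->
  (forall eps : R, 0 < eps -> exists N : nat, forall (T : finType) (G : {set {set T}}),
     (N <= #|T|)%N -> three_graph G -> ~~ contains_copy H G ->
     #|G|%:R <= (a + eps) * 'C(#|T|, 3)%:R) ->
  (forall eps : R, 0 < eps -> exists N : nat, forall n, (N <= n)%N ->
     (a - eps) * 'C(n, 3)%:R <= (turan_ex H n)%:R) ->
  (turan_ratio R H @ \oo --> a)%classic.
Proof.
move=> a0 upper lower; apply/cvgrPdist_le => eps eps0.
have [N1 hN1] := upper _ eps0; have [N2 hN2] := lower _ eps0.
exists (N1 + N2 + 3)%N => // n /= hn.
have bin0 : 0 < 'C(n, 3)%:R :> R by rewrite ltr0n bin_gt0; lia.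
rewrite ler_distlC /turan_ratio ler_pdivlMr // ler_pdivrMr //; apply/andP; split.
  by apply: hN2; lia.
rewrite /turan_ex; elim/big_ind: _ => [|x y hx hy|G /andP[G3 Gfree]].
(* The default value 0 of the maximum obeys the bound because [0 <= a]. *)
- by rewrite mulr_ge0 // addr_ge0 // ltW.
- by rewrite /maxn; case: ifP.
by have := hN1 'I_n G; rewrite card_ord; apply=> //; lia.
Qed.

Lemma cvg_turan_ratio_tight_cycle_minus (R : realType) (l : nat) : (5 <= l)%N ->
  (turan_ratio R (tight_cycle_minus l) @ \oo --> (if (3 %| l)%N then 0 else 4^-1 : R))%classic.
Proof.
move=> l5; apply: cvg_turan_ratio => [|eps|eps eps0].
- by case: ifP.
- apply: copy_free_upper => [|m E HE noE]; first by case: ifP.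
  case: ifPn => l3.
    (* Any edge would carry a closed walk of length [l], so there are none. *)
    rewrite mul0r big1 // => i _; rewrite big1 // => j _; rewrite big1 // => k _.
    case h : (E i j k) => //.
    have [|s sl hs] := @minus_cycle_walk_dvd3 _ E l i j k HE _ l3 h; first by lia.
    by have := noE s sl; rewrite hs.
  have := @triple_count_le _ E HE; rewrite card_ord => h.
  rewrite mulrC ler_pdivlMr // -natrX -natrM ler_nat mulnC; apply: h.
  move=> a b c d e h1 h2 h3 h4.
  have [s sl hs] := minus_cycle_walk_not_dvd3 HE l5 l3 h1 h2 h3 h4.
  by have := noE s sl; rewrite hs.
case: ifPn => l3.
  by exists 0%N => n _; rewrite sub0r mulNr (@le_trans _ _ 0) // oppr_le0 mulr_ge0 // ltW.
have [N hN] := ternary_graph_dense eps0; exists N => n /hN /le_trans; apply.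
rewrite ler_nat; apply: leq_bigmax_cond.
by rewrite ternary_three_graph ternary_graph_free //; lia.
Qed.

Theorem theorem5 (R : realType) (l : nat) (hl : (5 <= l)%N) :
  cvgn (turan_ratio R (tight_cycle_minus l)) /\
  turan_density R (tight_cycle_minus l) = (if (3 %| l)%N then 0 else 4^-1).
Proof.
have h := @cvg_turan_ratio_tight_cycle_minus R l hl.
by split; [apply/cvg_ex; eexists; exact: h|exact: cvg_lim h].
Qed.
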